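(* Let $R$ be a commutative Noetherian ring with identity and let $M$ be a nonzero (unitary) $R$-module. Then the following statements are equivalent: (1) $M$ is a weakly Laskerian $R$-module; (2) $M$ is an FSF $R$-module.
   Context: An $R$-module $M$ is called weakly Laskerian if the set of associated primes $\mathrm{Ass}_R(M/N)$ is finite for each proper submodule $N$ of $M$. An $R$-module $M$ is called FSF if there exists a finitely generated submodule $N$ of $M$ such that the support $\mathrm{Supp}_R(M/N)=\{\mathfrak p\in \mathrm{Spec}\,R : (M/N)_{\mathfrak p}\neq 0\}$ is a finite set. *)

(* Defs.v *)
From HB Require Import structures.
From mathcomp Require Import all_boot all_order all_algebra.
From mathcomp Require Import generic_quotient ring_quotient.
From mathcomp Require Import boolp classical_sets cardinality ring.

Set Implicit Arguments.
Unset Strict Implicit.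
Unset Printing Implicit Defensive.

Import GRing.Theory.

Local Open Scope ring_scope.
Local Open Scope quotient_scope.
Local Open Scope classical_set_scope.

(* Submodules of M are the bundled predicates [N : submodClosed M] and prime
   ideals of R the bundled predicates [p : prime_idealr R] (proper ideals).
   They are boolean valued, which classically is no restriction. *)

Section QuotientModule.
Variables (R : pzRingType) (M : lmodType R) (N : submodClosed M).

(* An alias of N: [submodClosed] does not inherit from [zmodClosed], which the
   construction of ring_quotient expects. *)
Definition submod_pred : {pred M} := fun x => x \in N.

Fact submod_pred_zmod_closed : zmod_closed submod_pred.
Proof. exact: GRing.submod_closedB (submodClosedP N). Qed.

HB.instance Definition _ :=
  GRing.isZmodClosed.Build M submod_pred submod_pred_zmod_closed.

Definition quotmod := Quotient.quot submod_pred.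

HB.instance Definition _ := GRing.Zmodule.on quotmod.
HB.instance Definition _ := EqQuotient.on quotmod.

Definition quotmod_scale (a : R) (u : quotmod) : quotmod :=
  \pi_quotmod (a *: repr u).

Lemma quotmod_eqP (x y : M) :
  reflect (\pi_quotmod x = \pi_quotmod y) (x - y \in N).
Proof.
apply: (iffP idP) => [xyN | /eqP].
  by apply/eqP; rewrite -Quotient.idealrBE.
by rewrite -Quotient.idealrBE.
Qed.

Lemma quotmod_piD (x y : M) :
  \pi_quotmod (x + y) = \pi_quotmod x + \pi_quotmod y.
Proof. by rewrite !piE. Qed.

Lemma quotmod_scaleE a x : quotmod_scale a (\pi_quotmod x) = \pi_quotmod (a *: x).
Proof.
apply/quotmod_eqP; rewrite -scalerBr rpredZ //.
by apply/quotmod_eqP; rewrite reprK.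
Qed.

Fact quotmod_scaleA a b u :
  quotmod_scale a (quotmod_scale b u) = quotmod_scale (a * b) u.
Proof. by rewrite -[u]reprK (quotmod_scaleE b) !quotmod_scaleE scalerA. Qed.

Fact quotmod_scale1 : left_id 1 quotmod_scale.
Proof. by move=> u; rewrite -[u]reprK quotmod_scaleE scale1r. Qed.

Fact quotmod_scaleDr : right_distributive quotmod_scale +%R.
Proof.
move=> a u v; rewrite -[u]reprK -[v]reprK.
by rewrite -quotmod_piD !quotmod_scaleE scalerDr quotmod_piD.
Qed.

Fact quotmod_scaleDl u : {morph quotmod_scale^~ u : a b / a + b}.
Proof.
by move=> a b; rewrite -[u]reprK !quotmod_scaleE scalerDl quotmod_piD.
Qed.

HB.instance Definition _ := GRing.Zmodule_isLmodule.Build R quotmod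
  quotmod_scaleA quotmod_scale1 quotmod_scaleDr quotmod_scaleDl.

End QuotientModule.

(* The localization M_p: classes of fractions m/s with s outside p, where
   m/s = m'/s' iff t (s' m - s m') = 0 for some t outside p. *)
Section Localization.
Variables (R : comNzRingType) (M : lmodType R) (p : prime_idealr R).

Definition denom := {s : R | s \notin p}.

Fact denom1_subproof : 1 \notin p.
Proof. by rewrite idealr1. Qed.

Fact denomM_subproof (s t : denom) : val s * val t \notin p.
Proof. by rewrite prime_idealrM negb_or (valP s) (valP t). Qed.

Definition denom1 : denom := Sub 1 denom1_subproof.
Definition denomM (s t : denom) : denom :=
  Sub (val s * val t) (denomM_subproof s t).

Definition frac := (M * denom)%type.
HB.instance Definition _ := Choice.on frac.

Definition frac_eq (u v : frac) : bool :=
  `[< exists t : denom, val t *: (val v.2 *: u.1 - val u.2 *: v.1) = 0 >].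

Fact frac_eq_is_equiv : equiv_class_of frac_eq.
Proof.
split=> [[x s]|[x s] [y t]|[y t] [x s] [z r]].
- by apply/asboolP; exists denom1; rewrite subrr scaler0.
- by apply/asbool_equiv_eq; split=> -[w /= e]; exists w;
    rewrite -opprB scalerN e oppr0.
move=> /asboolP [w /= e1] /asboolP [v /= e2]; apply/asboolP.
exists (denomM (denomM w v) t) => /=.
have -> : val w * val v * val t *: (val r *: x - val s *: z) =
   (val v * val r) *: (val w *: (val t *: x - val s *: y))
  + (val w * val s) *: (val v *: (val r *: y - val t *: z)).
  rewrite !scalerBr !scalerA addrA (_ : val v * val r * val w * val s =
    val w * val s * val v * val r); last by ring.
  rewrite subrK; congr (_ *: _ - _ *: _); ring.
by rewrite e1 e2 !scaler0 addr0.
Qed.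
Canonical frac_eq_equiv := EquivRelPack frac_eq_is_equiv.

Definition localization := {eq_quot frac_eq}.
HB.instance Definition _ : EqQuotient frac frac_eq localization :=
  EqQuotient.on localization.
HB.instance Definition _ := Choice.on localization.

Definition to_loc (m : M) (s : denom) : localization := \pi_localization (m, s).

Lemma loc_surj (u : localization) : exists m s, u = to_loc m s.
Proof.
by exists (repr u).1, (repr u).2; rewrite /to_loc -surjective_pairing reprK.
Qed.

Lemma loc_eqP (m m' : M) (s s' : denom) :
  to_loc m s = to_loc m' s' <->
  exists t : denom, val t *: (val s' *: m - val s *: m') = 0.
Proof.
split=> [/eqmodP /asboolP //|h]; exact/eqmodP/asboolP.
Qed.

Definition loc_zero : localization := to_loc 0 denom1.

Definition loc_opp (u : localization) : localization :=
  to_loc (- (repr u).1) (repr u).2.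

Definition loc_add (u v : localization) : localization :=
  to_loc (val (repr v).2 *: (repr u).1 + val (repr u).2 *: (repr v).1)
    (denomM (repr u).2 (repr v).2).

Definition loc_scale (a : R) (u : localization) : localization :=
  to_loc (a *: (repr u).1) (repr u).2.

Lemma loc_oppE m s : loc_opp (to_loc m s) = to_loc (- m) s.
Proof.
rewrite /loc_opp; case E : (repr _) => [x r] /=.
have /loc_eqP [t e] : to_loc x r = to_loc m s by rewrite {1}/to_loc -E reprK.
by apply/loc_eqP; exists t; rewrite !scalerN -opprD scalerN e oppr0.
Qed.

Lemma loc_scaleE a m s : loc_scale a (to_loc m s) = to_loc (a *: m) s.
Proof.
rewrite /loc_scale; case E : (repr _) => [x r] /=.
have /loc_eqP [t e] : to_loc x r = to_loc m s by rewrite {1}/to_loc -E reprK.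
apply/loc_eqP; exists t; rewrite !(scalerA _ a) ![_ * a]mulrC -!(scalerA a).
by rewrite -scalerBr scalerA mulrC -scalerA e scaler0.
Qed.

Lemma loc_addE m s m' s' : loc_add (to_loc m s) (to_loc m' s') =
  to_loc (val s' *: m + val s *: m') (denomM s s').
Proof.
rewrite /loc_add.
case E : (repr (to_loc m s)) => [x r]; case E' : (repr _) => [x' r'] /=.
have /loc_eqP [t e] : to_loc x r = to_loc m s by rewrite {1}/to_loc -E reprK.
have /loc_eqP [t' e'] : to_loc x' r' = to_loc m' s'.
  by rewrite {1}/to_loc -E' reprK.
apply/loc_eqP; exists (denomM t t') => /=.
have -> : val t * val t' *: ((val s * val s') *: (val r' *: x + val r *: x')
    - (val r * val r') *: (val s' *: m + val s *: m')) =
  (val t' * val s' * val r') *: (val t *: (val s *: x - val r *: m)) +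
  (val t * val s * val r) *: (val t' *: (val s' *: x' - val r' *: m')).
  rewrite !(scalerBr, scalerDr) !scalerA opprD addrACA.
  by congr (_ *: _ - _ *: _ + (_ *: _ - _ *: _)); ring.
by rewrite e e' !scaler0 addr0.
Qed.

Lemma to_loc_eq m m' s s' : val s' *: m = val s *: m' -> to_loc m s = to_loc m' s'.
Proof.
by move=> e; apply/loc_eqP; exists denom1; rewrite e subrr scaler0.
Qed.

Fact loc_addA : associative loc_add.
Proof.
move=> u v w; have [x [r ->]] := loc_surj u; have [y [s ->]] := loc_surj v.
have [z [t ->]] := loc_surj w; rewrite !loc_addE; apply: to_loc_eq => /=.
rewrite !scalerDr !scalerA !addrA.
by congr (_ *: _ + _ *: _ + _ *: _); ring.
Qed.

Fact loc_addC : commutative loc_add.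
Proof.
move=> u v; have [x [r ->]] := loc_surj u; have [y [s ->]] := loc_surj v.
rewrite !loc_addE; apply: to_loc_eq => /=.
by rewrite addrC [val s * _]mulrC.
Qed.

Fact loc_add0 : left_id loc_zero loc_add.
Proof.
move=> u; have [x [r ->]] := loc_surj u; rewrite loc_addE.
by apply: to_loc_eq => /=; rewrite scaler0 add0r scale1r mul1r.
Qed.

Fact loc_addN : left_inverse loc_zero loc_opp loc_add.
Proof.
move=> u; have [x [r ->]] := loc_surj u; rewrite loc_oppE loc_addE.
by apply: to_loc_eq => /=; rewrite scalerN addNr !scaler0.
Qed.

HB.instance Definition _ := GRing.isZmodule.Build localization
  loc_addA loc_addC loc_add0 loc_addN.

Lemma to_locD m s m' s' : to_loc m s + to_loc m' s' =
  to_loc (val s' *: m + val s *: m') (denomM s s').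
Proof. exact: loc_addE. Qed.

Lemma to_loc_eq0 m s :
  to_loc m s = 0 <-> exists2 t : R, t \notin p & t *: m = 0.
Proof.
split=> [/loc_eqP [t /=]|[t tp e]].
  by rewrite scaler0 subr0 scale1r; exists (val t) => //; exact: (valP t).
by apply/loc_eqP; exists (Sub t tp); rewrite /= scaler0 subr0 scale1r.
Qed.

Fact loc_scaleA a b u : loc_scale a (loc_scale b u) = loc_scale (a * b) u.
Proof.
by have [x [r ->]] := loc_surj u; rewrite (loc_scaleE b) !loc_scaleE scalerA.
Qed.

Fact loc_scale1 : left_id 1 loc_scale.
Proof.
by move=> u; have [x [r ->]] := loc_surj u; rewrite loc_scaleE scale1r.
Qed.

Fact loc_scaleDr : right_distributive loc_scale +%R.
Proof.
move=> a u v; have [x [r ->]] := loc_surj u; have [y [s ->]] := loc_surj v.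
rewrite to_locD !loc_scaleE to_locD; apply: to_loc_eq => /=.
congr (_ *: _); rewrite scalerDr !scalerA.
by congr (_ *: _ + _ *: _); rewrite mulrC.
Qed.

Fact loc_scaleDl u : {morph loc_scale^~ u : a b / a + b}.
Proof.
move=> a b; have [x [r ->]] := loc_surj u; rewrite /= !loc_scaleE.
rewrite to_locD; apply: to_loc_eq => /=.
by rewrite -scalerDr -scalerDl [RHS]scalerA.
Qed.

HB.instance Definition _ := GRing.Zmodule_isLmodule.Build R localization
  loc_scaleA loc_scale1 loc_scaleDr loc_scaleDl.

End Localization.

Definition Ann (R : pzRingType) (M : lmodType R) (x : M) : {pred R} :=
  fun a => a *: x == 0.

(* Ass and Supp are sets of subsets of R: the bundles [prime_idealr R] live in
   a universe too high to be collected in a [set]. *)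
Definition Ass (R : comNzRingType) (M : lmodType R) : set (set R) :=
  [set P | exists p : prime_idealr R,
     P = [set` p] /\ exists x : M, p =i Ann x].

Definition Supp (R : comNzRingType) (M : lmodType R) : set (set R) :=
  [set P | exists p : prime_idealr R,
     P = [set` p] /\ exists u : localization M p, u != 0].

Definition fin_gen (R : pzRingType) (M : lmodType R) (N : submodClosed M) :=
  exists (n : nat) (e : 'I_n -> M), forall x : M,
    x \in N <-> exists c : 'I_n -> R, x = \sum_(i < n) c i *: e i.

(* Ideals of R, R itself included, are the submodules of the R-module R^o. *)
Definition noetherian (R : comNzRingType) :=
  forall I : submodClosed R^o, fin_gen I.

Definition weakly_laskerian (R : comNzRingType) (M : lmodType R) :=
  forall N : submodClosed M, (exists x : M, x \notin N) ->
    finite_set (Ass (quotmod N)).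

Definition FSF (R : comNzRingType) (M : lmodType R) :=
  exists N : submodClosed M, fin_gen N /\ finite_set (Supp (quotmod N)).

(* Main.v *)
(* (2) => (1): for a submodule L, Ass(M/L) is contained in
   Ass(M/(L+N)) together with finitely many primes coming from the finitely
   generated part N, and Ass(M/(L+N)) <= Supp(M/N).

   (1) => (2): suppose Supp(M/F) is infinite for every finitely generated F.
   We choose x_0, x_1, ... in M and distinct primes q_0, q_1, ..., each with
   only finitely many primes above it, such that L = sum q_i x_i satisfies
   (L : x_i) = q_i, so that Ass(M/L) is infinite. Given x_i and q_i for i < n,
   put F = sum R x_i. As Ass(M/F) is finite, some P = (F : z) in it has
   infinitely many primes above it, so P contains no q_i and some c outside P
   lies in all of them. Then x_n = c z satisfies (F : x_n) = P and
   P x_n <= c F <= sum q_i x_i, hence any q_n above P can be added without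
   altering the previous (L : x_i). A maximal prime above P with infinitely
   many primes above it shows that infinitely many such q_n exist. *)

From HB Require Import structures.
Require Import Defs.
From mathcomp Require Import all_boot all_order all_algebra.
From mathcomp Require Import generic_quotient ring_quotient.
From mathcomp Require Import boolp classical_sets cardinality.

Set Implicit Arguments.
Unset Strict Implicit.
Unset Printing Implicit Defensive.

Import GRing.Theory.

Local Open Scope ring_scope.
Local Open Scope quotient_scope.
Local Open Scope classical_set_scope.

(** * Submodules and ideals as plain sets *)

Definition is_submod (R : pzRingType) (M : lmodType R) (N : set M) :=
  N 0 /\ forall a x y, N x -> N y -> N (a *: x + y).

Definition is_prime (R : comNzRingType) (P : set R) :=
  [/\ @is_submod R R^o P, ~ P 1 & forall a b, P (a * b) -> P a \/ P b].

Section Submodules.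
Variables (R : comNzRingType) (M : lmodType R).
Implicit Types (N L : set M).

Lemma submodD N x y : is_submod N -> N x -> N y -> N (x + y).
Proof. by move=> [_ NP] Nx Ny; rewrite -[x]scale1r; apply: NP. Qed.

Lemma submodZ N a x : is_submod N -> N x -> N (a *: x).
Proof. by move=> [N0 NP] Nx; rewrite -[_ *: _]addr0; apply: NP. Qed.

Lemma submodB N x y : is_submod N -> N x -> N y -> N (x - y).
Proof.
move=> NP Nx Ny; apply: submodD => //; rewrite -scaleN1r; exact: submodZ.
Qed.

Lemma submod_mem (N : submodClosed M) : is_submod [set` N].
Proof.
by split=> [|a x y] /=; [exact: rpred0|move=> *; rewrite rpredD ?rpredZ].
Qed.

Lemma submod_bundle N :
  is_submod N -> exists N' : submodClosed M, N = [set` N'].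
Proof.
move=> [N0 NP]; pose S : {pred M} := fun x => `[< N x >].
have S_closed : submod_closed S.
  by split=> [|a x y /asboolP Nx /asboolP Ny]; apply/asboolP => //; exact: NP.
pose N' : submodClosed M :=
  HB.pack (S : M -> bool) (GRing.isSubmodClosed.Build R M S S_closed).
exists N'; apply/seteqP; split=> x /=; first by move=> /asboolP.
by move=> /asboolP.
Qed.

Definition colon N x : set R := [set a | N (a *: x)].

Lemma submod_colon N x : is_submod N -> @is_submod R R^o (colon N x).
Proof.
move=> NP; split; first by rewrite /colon /= scale0r; case: NP.
move=> a b c; rewrite /colon /= => Nb Nc; rewrite scalerDl; apply: submodD => //.
by rewrite -scalerA; exact: submodZ.
Qed.

Definition add_gen x N : set M := [set m | exists a n, N n /\ m = a *: x + n].

Lemma submod_add_gen x N : is_submod N -> is_submod (add_gen x N).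
Proof.
move=> NP; split; first by exists 0, 0; split; [case: NP|rewrite scale0r addr0].
move=> a _ _ [b [m [Nm ->]]] [c [n [Nn ->]]].
exists (a * b + c), (a *: m + n); split; first by case: NP => _; apply.
by rewrite scalerDl scalerDr -scalerA addrACA.
Qed.

Lemma sub_add_gen x N : N `<=` add_gen x N.
Proof. by move=> m Nm; exists 0, m; rewrite scale0r add0r. Qed.

Lemma mem_add_gen x N : is_submod N -> add_gen x N x.
Proof. by move=> [N0 _]; exists 1, 0; rewrite scale1r addr0. Qed.

(** These are [Ass(M/N)] and [Supp(M/N)]: [colon N x] is the annihilator of the class of [x], so
    neither a quotient nor a localization has to be formed. *)
Definition ass N : set (set R) :=
  [set P | is_prime P /\ exists x, P = colon N x].

Definition supp N : set (set R) :=
  [set P | is_prime P /\ exists x, colon N x `<=` P].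

End Submodules.

(** * Passage between the bundled and the set-based notions *)

Section Primes.
Variable R : comNzRingType.

Lemma prime_mem (p : prime_idealr R) : is_prime [set` p].
Proof.
split=> [|/=|a b /=]; last 2 first.
- by rewrite idealr1.
- by rewrite prime_idealrM => /orP.
split=> [|a x y] /=; first exact: rpred0.
by move=> px py; rewrite rpredD // idealMr.
Qed.

Lemma prime_bundle (P : set R) :
  is_prime P -> exists p : prime_idealr R, P = [set` p].
Proof.
move=> [PI P1 PM]; pose S : {pred R} := fun x => `[< P x >].
have S_ideal : idealr_closed S.
  split=> [||a x y /asboolP Px /asboolP Py]; first by apply/asboolP; case: PI.
    by apply/asboolP.
  by apply/asboolP; case: PI => _; apply.
have S_prime : prime_idealr_closed S.
  by move=> a b /asboolP /PM [] ?; apply/orP; [left|right]; apply/asboolP.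
pose p : prime_idealr R := HB.pack (S : R -> bool)
  (isIdealr.Build R S S_ideal) (isPrimeIdealrClosed.Build R S S_prime).
exists p; apply/seteqP; split=> x /=; first by move=> /asboolP.
by move=> /asboolP.
Qed.

Variable M : lmodType R.

Lemma quotmod_eq0 (N : submodClosed M) (x : M) :
  \pi_(quotmod N) x = 0 <-> x \in N.
Proof.
have -> : 0 = \pi_(quotmod N) 0 by rewrite !piE.
split=> [/quotmod_eqP|xN]; first by rewrite subr0.
by apply/quotmod_eqP; rewrite subr0.
Qed.

Lemma quotmodZ (N : submodClosed M) a (x : M) :
  a *: \pi_(quotmod N) x = \pi_(quotmod N) (a *: x).
Proof. exact: quotmod_scaleE. Qed.

Lemma Ass_quotmod (N : submodClosed M) : Ass (quotmod N) = ass [set` N].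
Proof.
apply/seteqP; split=> P.
  move=> [p [-> [u pu]]]; split; first exact: prime_mem.
  exists (repr u); apply/seteqP; split=> a /=; rewrite pu unfold_in.
    by move=> /eqP au0; apply/quotmod_eq0; rewrite -quotmodZ reprK.
  by move=> /quotmod_eq0; rewrite -quotmodZ reprK => ->.
move=> [/prime_bundle [p ->] [x e]]; exists p; split=> //.
exists (\pi x) => a; rewrite [RHS]unfold_in [X in _ = (X == 0)]quotmodZ.
have [e1 e2] : (a \in p -> a *: x \in N) /\ (a *: x \in N -> a \in p).
  by move/seteqP: e => [h1 h2]; split; [apply: h1|apply: h2].
by apply/idP/eqP => [/e1 /quotmod_eq0|/quotmod_eq0 /e2].
Qed.

(** A fraction [m/s] is nonzero at [p] exactly when no element outside [p] kills [m], that is, when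
    the annihilator of [m] lies in [p]. *)
Lemma Supp_quotmod (N : submodClosed M) : Supp (quotmod N) = supp [set` N].
Proof.
apply/seteqP; split=> P.
  move=> [p [-> [u]]]; have [m [s ->]] := loc_surj u => nz.
  split; first exact: prime_mem.
  exists (repr m) => a /= /quotmod_eq0; rewrite -quotmodZ reprK => am0.
  apply: contraNT nz => ap; apply/eqP/to_loc_eq0.
  by exists a.
move=> [/prime_bundle [p ->] [x e]]; exists p; split=> //.
exists (to_loc (\pi x : quotmod N) (denom1 p)); apply/eqP => /to_loc_eq0 [t tp].
by rewrite quotmodZ => /quotmod_eq0 /e /=; apply/negP.
Qed.

End Primes.

(** * Chain and maximality conditions *)

Section Noetherian.
Variable R : comNzRingType.
Hypothesis hR : noetherian R.

(** The union of the chain is a finitely generated ideal; the chain stops once it contains all the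
    generators. *)
Lemma noetherian_acc (I : nat -> set R) :
  (forall n, @is_submod R R^o (I n)) -> (forall n, I n `<=` I n.+1) ->
  exists n, I n.+1 `<=` I n.
Proof.
move=> IP Isub.
have Imono m n : (m <= n)%N -> I m `<=` I n.
  elim: n => [|n IHn]; first by rewrite leqn0 => /eqP ->.
  rewrite leq_eqVlt => /orP [/eqP -> //|/IHn h].
  by apply: subset_trans h _; exact: Isub.
pose U : set R^o := [set a | exists n, I n a].
have UP : is_submod U.
  split; first by exists 0; case: (IP 0).
  move=> a x y [m Im] [n In]; exists (maxn m n).
  case: (IP (maxn m n)) => _; apply.
    by apply: Imono Im; exact: leq_maxl.
  by apply: Imono In; exact: leq_maxr.
have [U' UE] := submod_bundle UP; have [k [e eP]] := hR U'.
have Ue i : U (e i).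
  rewrite UE; apply/eP; exists (fun j => (j == i)%:R).
  rewrite (bigD1 i) //= eqxx scale1r big1 ?addr0 // => j /negPf ->.
  by rewrite scale0r.
have [f fP] := choice Ue.
exists (\max_i f i) => a Ia.
have : U a by exists (\max_i f i).+1.
rewrite UE => /eP [c ->].
have IN := IP (\max_i f i).
apply: (big_ind (I (\max_i f i))) => [|x y|i _]; first by case: IN.
  exact: (submodD IN).
apply: (submodZ _ IN); apply: Imono (fP i).
exact: leq_bigmax.
Qed.

(** Otherwise each member of [F] above [I0] has a strictly larger one, and iterating a choice of
    these contradicts [noetherian_acc]. *)
Lemma noetherian_max (F : set (set R)) (I0 : set R) :
    (forall I, F I -> @is_submod R R^o I) -> F I0 ->
  exists I, [/\ F I, I0 `<=` I & forall J, F J -> I `<=` J -> J = I].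
Proof.
move=> FP FI0; apply: contrapT => noI.
pose T := {I | F I /\ I0 `<=` I}.
have step (I : T) : exists J : T, sval I `<=` sval J /\ ~ (sval J `<=` sval I).
  case: I => I [FI I0I] /=; apply: contrapT => noJ; apply: noI.
  exists I; split=> // J FJ IJ; apply/seteqP; split=> //; apply: contrapT => nJI.
  by apply: noJ; exists (exist _ J (conj FJ (subset_trans I0I IJ))).
have [f fP] := choice step.
pose I n := iter n f (exist _ I0 (conj FI0 (@subset_refl _ I0)) : T).
have [|n|n] := @noetherian_acc (fun n => sval (I n)).
- by move=> n; apply: FP; case: (svalP (I n)).
- by case: (fP (I n)).
- by case: (fP (I n)).
Qed.

(** * Associated primes and support *)

Section AssociatedPrimes.
Variable M : lmodType R.
Implicit Types (N L : set M).

Lemma ass_sub_supp N : ass N `<=` supp N.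
Proof. by move=> P [PP [x e]]; split=> //; exists x; rewrite e. Qed.

Lemma supp_anti N L : N `<=` L -> supp L `<=` supp N.
Proof.
move=> NL P [PP [x xP]]; split=> //; exists x => a Na; apply: xP; exact: NL.
Qed.

(** A maximal element among the colon ideals contained in [P] is prime. *)
Lemma supp_has_ass N P : is_submod N -> supp N P -> exists2 Q, ass N Q & Q `<=` P.
Proof.
move=> NP [PP [x xP]].
pose F : set (set R) := [set I | I `<=` P /\ exists y, I = colon N y].
have [||Q [[QP [y Qy]] _ Qmax]] := @noetherian_max F (colon N x).
- by move=> I [_ [y ->]]; exact: submod_colon.
- by split=> //; exists x.
case: PP => _ P1 PM.
exists Q => //; split; last by exists y.
rewrite Qy; split; first exact: submod_colon.
  by rewrite -Qy => /QP.
move=> a b Nab; apply: contrapT => /not_orP [na nb].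
(* Without such a [t], [colon N (b *: y)] would lie in [P], hence equal [Q] by maximality, and it
   contains [a]. *)
have [t tP Ntb] : exists2 t, ~ P t & N (t *: (b *: y)).
  apply: contrapT => h; apply: na.
  have /Qmax : F (colon N (b *: y)).
    split; last by exists (b *: y).
    by move=> t Nt; apply: contrapT => Pt; apply: h; exists t.
  rewrite Qy => <-; first by rewrite /colon /= scalerA.
  by move=> c Nc; rewrite /colon /= scalerA mulrC -scalerA; exact: submodZ.
apply: nb.
(* As [t] is outside the prime [P], this colon ideal stays inside [P]; by maximality it is [Q], and
   it contains [b]. *)
have /Qmax : F (colon N (t *: y)).
  split; last by exists (t *: y).
  move=> c; rewrite /colon /= scalerA => Nct.
  have /QP /PM [//|] : Q (c * t) by rewrite Qy.
  by move=> /tP.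
rewrite Qy => <-; first by rewrite /colon /= scalerA mulrC -scalerA.
by move=> c Nc; rewrite /colon /= scalerA mulrC -scalerA; exact: submodZ.
Qed.

(* If [P = N : z] and [R z] meets [N + R x] outside [N], say in [a z = r x + n],
   then [P = N : a z = (N : x) : r]. *)
Lemma ass_add_gen N x : is_submod N ->
  ass N `<=` ass (add_gen x N) `|` @ass R R^o (colon N x).
Proof.
move=> NP P [PP [z Pz]].
have [h|/existsNP [a /not_implyP [Ka Na]]] :=
    pselect (forall a, add_gen x N (a *: z) -> N (a *: z)).
  left; split=> //; exists z; rewrite Pz; apply/seteqP; split=> a /=.
    exact: sub_add_gen.
  exact: h.
right; split=> //; have [r [n [Nn e]]] := Ka; exists r.
have brE b : b *: (a *: z) = b * r *: x + b *: n by rewrite e scalerDr scalerA.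
case: PP => [PI P1 PM].
apply/seteqP; split=> b.
  rewrite Pz /colon /= => Nb.
  have -> : (b *: (r : R^o)) *: x = b *: (a *: z) - b *: n by rewrite brE addrK.
  apply: submodB => //; last exact: submodZ.
  by rewrite scalerA mulrC -scalerA; exact: submodZ.
move=> Nb; have : P (b * a).
  rewrite Pz /colon /= -scalerA brE; apply: submodD => //; exact: submodZ.
by move=> /PM [//|]; rewrite Pz => /Na.
Qed.

End AssociatedPrimes.

(** Noetherian induction: take a maximal counterexample [I] and adjoin some [r] whose colon ideal
    [P0] is an associated prime. By [ass_add_gen], the primes come from the larger ideal or from
    [P0], whose only associated prime is [P0]. *)
Lemma finite_ass_ideal (J : set R) :
  @is_submod R R^o J -> finite_set (@ass R R^o J).
Proof.
move=> JP; apply: contrapT => infJ.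
pose F : set (set R) := [set I | @is_submod R R^o I /\ ~ finite_set (@ass R R^o I)].
have [||I [[IP infI] _ Imax]] := @noetherian_max F J.
- by move=> ? [].
- by [].
have [P0 [[PI P1 PM] [r Pr]]] : @ass R R^o I !=set0 by exact: infinite_setN0.
have KP := @submod_add_gen R R^o (r : R) _ IP.
apply: infI; apply: sub_finite_set (@ass_add_gen R^o I r IP) _.
rewrite finite_setU; split.
  apply: contrapT => infK.
  have /Imax : F (@add_gen R R^o (r : R) I) by [].
  move=> /(_ (@sub_add_gen R R^o r I)) KI; apply: P1; rewrite Pr /colon /=.
  by rewrite scale1r -KI; apply: mem_add_gen.
apply: sub_finite_set (finite_set1 P0) => Q [[QI Q1 QM] [s]].
rewrite -Pr => Qs /=.
have P0s : ~ P0 s.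
  by move=> P0s; apply: Q1; rewrite Qs /colon /= scale1r.
rewrite Qs; apply/seteqP; split=> a; rewrite /colon /=; first by move=> /PM [].
by move=> Pa; rewrite [_ *: _]mulrC; exact: (@submodZ R R^o).
Qed.

(** * Adjoining finitely many generators; FSF implies weakly Laskerian *)

Section FiniteGeneration.
Variable M : lmodType R.
Implicit Types (N L : set M).

Lemma submod_add_gens N xs : is_submod N -> is_submod (foldr (@add_gen R M) N xs).
Proof. by move=> NP; elim: xs => //= x xs; exact: submod_add_gen. Qed.

Lemma sub_add_gens N xs : N `<=` foldr (@add_gen R M) N xs.
Proof.
by elim: xs => //= x xs h; apply: subset_trans h _; exact: sub_add_gen.
Qed.

Lemma mem_add_gens N xs x :
  is_submod N -> x \in xs -> foldr (@add_gen R M) N xs x.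
Proof.
move=> NP; elim: xs => //= y xs IHxs; rewrite inE => /orP [/eqP ->|/IHxs].
  by apply: mem_add_gen; exact: submod_add_gens.
exact: sub_add_gen.
Qed.

(** By [ass_add_gen], each adjunction loses only associated primes of a colon ideal of [R], and
    these are finite in number. *)
Lemma finite_ass_add_gens N xs : is_submod N ->
  finite_set (ass (foldr (@add_gen R M) N xs)) -> finite_set (ass N).
Proof.
move=> NP; elim: xs => //= x xs IHxs fin; apply: IHxs.
have KP := @submod_add_gens N xs NP.
apply: sub_finite_set (@ass_add_gen _ _ x KP) _; rewrite finite_setU; split=> //.
by apply: finite_ass_ideal; exact: submod_colon.
Qed.

Lemma fin_gen_add_gens (N : submodClosed M) xs :
  [set` N] = foldr (@add_gen R M) [set 0] xs -> fin_gen N.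
Proof.
move=> NE; exists (size xs), (fun i => xs`_i).
(* Coefficients are indexed by [nat] so that the induction can shift them; those on ['I_n] are later
   extended by zero. *)
have spanP x : foldr (@add_gen R M) [set 0] xs x <->
    exists c : nat -> R, x = \sum_(i < size xs) c i *: xs`_i.
  elim: xs {NE} x => [|y xs IHxs] x /=.
    split=> [->|[c ->]]; last by rewrite big_ord0.
    by exists (fun=> 0); rewrite big_ord0.
  split=> [[a [_ [/IHxs [c ->] ->]]]|[c ->]].
    exists (fun n => if n is n'.+1 then c n' else a).
    by rewrite big_ord_recl.
  rewrite big_ord_recl; exists (c 0), (\sum_(i < size xs) c i.+1 *: xs`_i).
  by split=> //; apply/IHxs; exists (fun n => c n.+1).
move=> x; have -> : (x \in N) = ([set` N] x) :> Prop by [].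
rewrite NE spanP; split=> [[c ->]|[c ->]]; first by exists (fun i => c i).
exists (fun n => oapp c 0 (insub n)); apply: eq_bigr => i _.
by rewrite valK.
Qed.

Lemma FSF_weakly_laskerian : FSF M -> weakly_laskerian M.
Proof.
move=> [N [[n [e eP]]]]; rewrite Supp_quotmod => finN L _; rewrite Ass_quotmod.
have LP := submod_mem L.
(* Adjoining the generators of [N] to [L] gives [K] containing [N], so [Ass(M/K)] lies in
   [Supp(M/N)]. *)
apply: (@finite_ass_add_gens _ (map e (enum 'I_n)) LP).
set K := foldr _ _ _; have KP : is_submod K by exact: submod_add_gens.
apply: sub_finite_set finN; apply: subset_trans (@ass_sub_supp _ _) _.
apply: supp_anti => x /eP [c ->].
apply: (big_ind K) => [|y z|i _]; first by case: KP.
  exact: submodD.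
apply: submodZ => //; apply: mem_add_gens => //.
by rewrite map_f // mem_enum.
Qed.

End FiniteGeneration.

(** * Primes with finitely many primes above them *)

Definition primes_above (P : set R) : set (set R) := [set Q | is_prime Q /\ P `<=` Q].

(** For [I] maximal among the primes above [P] with infinitely many primes above, any prime strictly
    above [I] has finitely many; infinitely many such primes remain, enough to avoid [A]. *)
Lemma infinite_primes_above (P : set R) (A : seq (set R)) :
    is_prime P -> ~ finite_set (primes_above P) ->
  exists Q, [/\ primes_above P Q, finite_set (primes_above Q) & Q \notin A].
Proof.
move=> PP infP.
pose F : set (set R) := [set I | is_prime I /\ ~ finite_set (primes_above I)].
have [||I [[IP infI] PI Imax]] := @noetherian_max F P.
- by move=> ? [[]].
- by [].
have [Q [[QP IQ] Qn]] : (primes_above I `\` [set` I :: A]) !=set0.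
  by apply: infinite_setN0; apply: infinite_setD infI (finite_seq _).
have [QI QA] : Q <> I /\ Q \notin A.
  split=> [e|]; first by apply: Qn; rewrite /= e mem_head.
  by apply/negP => QA; apply: Qn; rewrite /= inE QA orbT.
exists Q; split=> //; first by split=> //; exact: subset_trans IQ.
by apply: contrapT => infQ; apply: QI; exact: Imax.
Qed.

(** * Construction of a submodule with infinitely many associated primes *)

Section Construction.
Variable M : lmodType R.
Implicit Type s : seq (set R * M).

(** For a list of pairs [(q_i, x_i)], newest first, this is the sum of the [q_i x_i], while [full]
    is the sum of the [R x_i]. *)
Fixpoint gen s : set M :=
  if s is (q, x) :: s' then
    [set m | exists a n, [/\ q a, gen s' n & m = a *: x + n]]
  else [set 0].

Definition full s : set M := foldr (@add_gen R M) [set 0] (map snd s).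

(* The last condition says that, modulo [gen s], the submodules [R x] and
   [full s] intersect trivially and the annihilator of [x] is inside [q]. *)
Fixpoint good s : Prop :=
  if s is (q, x) :: s' then
    [/\ good s', is_prime q, finite_set (primes_above q), q \notin map fst s' &
      forall a, full s' (a *: x) -> q a /\ gen s' (a *: x)]
  else True.

Lemma submod0 : is_submod [set 0 : M].
Proof. by split=> // a x y -> ->; rewrite scaler0 addr0. Qed.

Lemma submod_full s : is_submod (full s).
Proof. exact: submod_add_gens submod0. Qed.

Lemma submod_gen s : good s -> is_submod (gen s).
Proof.
elim: s => [_|[q x] s IHs [/IHs [s0 sP] [[q0 qP] _ _] _ _ _]].
  exact: submod0.
split; first by exists 0, 0; rewrite scale0r addr0.
move=> a _ _ [b [m [qb sm ->]]] [c [n [qc sn ->]]].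
exists (a * b + c), (a *: m + n); split; [exact: qP|exact: sP|].
by rewrite scalerDl scalerDr -scalerA addrACA.
Qed.

Lemma gen_sub_full s : gen s `<=` full s.
Proof.
elim: s => [//|[q x] s IHs] _ [a [n [_ /IHs sn ->]]].
by exists a, n.
Qed.

Lemma gen_cat_full t s : good (t ++ s) -> gen (t ++ s) `&` full s `<=` gen s.
Proof.
elim: t => [_ m [] //|[q x] t IHt] /= [ts qP _ _ qx] _ [[a [n [qa tsn ->]]] sm].
apply: IHt => //; split=> //; apply: (submodD (submod_gen ts)) => //.
have full_cat : full s `<=` full (t ++ s).
  by rewrite /full map_cat foldr_cat; exact: sub_add_gens.
have [|//] := qx a.
rewrite -[_ *: _](addrK n); apply: (submodB (submod_full _)); first exact: full_cat.
exact: gen_sub_full.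
Qed.

Lemma gen_cat_colon t q x s :
  good (t ++ (q, x) :: s) -> colon (gen (t ++ (q, x) :: s)) x = q.
Proof.
move=> ts; have qxs : good ((q, x) :: s).
  by elim: t ts => [//|[? ?] t IHt [/IHt]].
have tsP := submod_gen ts.
have genqx : gen ((q, x) :: s) `<=` gen (t ++ (q, x) :: s).
  elim: t ts {tsP} => [_ m //|[q' x'] t IHt [ts [[q'0 _] _ _] _ _ _]].
  apply: subset_trans (IHt ts) _ => m m_in; exists 0, m.
  by rewrite scale0r add0r.
have := qxs => -[s_good [[q0 qP] _ _] _ _ qx].
have [s0 _] := submod_gen s_good.
apply/seteqP; split=> a.
  rewrite /colon /= => ax.
  have [b [n [qb sn e]]] : gen ((q, x) :: s) (a *: x).
    apply: (@gen_cat_full t) => //; split=> //.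
    by apply: (submodZ _ (submod_full _)); apply: mem_add_gen; exact: submod_full.
  (* Here [(a - b) *: x = n] lies in [full s], so [good] puts [a - b] in [q]. *)
  have [|qab _] := qx (a - b).
    by rewrite scalerBl e addrC addKr; exact: gen_sub_full.
  by rewrite -(subrK b a) -[_ - _]mul1r; exact: qP.
move=> qa; apply: genqx; exists a, 0; by rewrite addr0.
Qed.

(* Each [q] in the list has only finitely many primes above it, so it is not
   contained in [P]; the product of elements [q \ P] does the job. *)
Lemma good_killer s (P : set R) : good s -> is_prime P -> ~ finite_set (primes_above P) ->
  exists2 c, ~ P c & forall m, full s m -> gen s (c *: m).
Proof.
move=> + PP infP; have [PI P1 PM] := PP.
elim: s => [_|[q x] s IHs [sG qP finq _ _]].
  by exists 1 => // m ->; rewrite scaler0.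
have [c Pc cP] := IHs sG.
have [d qd Pd] : exists2 d, q d & ~ P d.
  apply: contrapT => h; apply: infP; apply: sub_finite_set finq => Q [QP PQ].
  split=> // a qa; apply: PQ; apply: contrapT => Pa.
  by apply: h; exists a.
exists (d * c) => [/PM []//|_ [a [n [sn ->]]]].
exists (d * c * a), ((d * c) *: n); rewrite scalerDr scalerA; split=> //.
  have [qI _ _] := qP; have := @submodZ R R^o q (c * a) d qI qd.
  by rewrite /GRing.scale /= mulrC mulrA.
by rewrite -scalerA; apply: submodZ (cP _ sn); exact: submod_gen.
Qed.

Lemma good_extend s : weakly_laskerian M -> ~ FSF M -> good s ->
  exists q x, good ((q, x) :: s).
Proof.
move=> WL nFSF sG; have [N NE] := submod_bundle (submod_full s).
have inf_supp : ~ finite_set (supp (full s)).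
  move=> fin; apply: nFSF; exists N; rewrite Supp_quotmod -NE; split=> //.
  by apply: (@fin_gen_add_gens _ _ (map snd s)); rewrite -NE.
(* [full s] is proper because its support is infinite, hence nonempty. *)
have fin_ass : finite_set (ass (full s)).
  have [P [[_ P1 _] [x xP]]] := infinite_setN0 inf_supp.
  rewrite NE -Ass_quotmod; apply: WL; exists x; apply/negP => Nx.
  by apply/P1/xP; rewrite NE /colon /= scale1r.
(* Every prime of the support contains an associated one, and there are finitely many of these. *)
have [P [PP [x Px]] infP] : exists2 P, ass (full s) P & ~ finite_set (primes_above P).
  apply: contrapT => h; apply: inf_supp.
  apply: (@sub_finite_set _ _ (\bigcup_(P in ass (full s)) primes_above P)).
    move=> Q QS; have [P PA PQ] := supp_has_ass (submod_full s) QS.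
    by exists P => //; case: QS.
  apply: bigcup_finite => // P PA; apply: contrapT => infP.
  by apply: h; exists P.
have [c Pc cP] := good_killer sG PP infP.
have [q [[qP Pq] finq qs]] := infinite_primes_above (map fst s) PP infP.
exists q, (c *: x); split=> // a; have [_ _ PM] := PP.
rewrite scalerA => acx.
have /PM [Pa|//] : P (a * c) by rewrite Px.
split; first exact: Pq.
by rewrite mulrC -scalerA; apply: cP; move: Pa; rewrite Px.
Qed.

Lemma weakly_laskerian_FSF : weakly_laskerian M -> FSF M.
Proof.
move=> WL; apply: contrapT => nFSF.
have step (s : {s | good s}) :
    exists t : {s | good s}, exists qx, sval t = qx :: sval s.
  case: s => s sG; have [q [x h]] := good_extend WL nFSF sG.
  by exists (exist _ _ h), (q, x).
have [f fP] := choice step.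
have [g gP] := choice fP.
pose S n := iter n f (exist good [::] I); pose s n := sval (S n).
have sS n : s n.+1 = g (S n) :: s n by rewrite /s /= gP.
have sG n : good (s n) by exact: svalP.
pose q n := (g (S n)).1; pose x n := (g (S n)).2.
have s_cat m n : exists t, s (m + n)%N = t ++ s n.
  elim: m => [|m [t IHm]]; first by exists [::].
  by exists (g (S (m + n)) :: t); rewrite sS IHm.
have genS n m : (n <= m)%N -> gen (s n) `<=` gen (s m).
  move=> /subnK <-; elim: (m - n)%N => [//|k IHk].
  apply: subset_trans IHk _ => y; rewrite addSn sS; have := sG (k + n).+1.
  rewrite sS; case: (g _) => a b /= [_ [[a0 _] _ _] _ _ _] ?.
  by exists 0, y; rewrite scale0r add0r.
pose L : set M := [set m | exists n, gen (s n) m].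
have LP : is_submod L.
  split; first by exists 0.
  move=> a y z [m sy] [n sz]; exists (maxn m n).
  case: (submod_gen (sG (maxn m n))) => _; apply.
    by apply: genS sy; exact: leq_maxl.
  by apply: genS sz; exact: leq_maxr.
have Lx n : colon L (x n) = q n.
  (* The pair [(q n, x n)] enters at stage [n.+1]; from then on the colon ideal of [x n] no longer
     changes. *)
  have colonS m : colon (gen (s (m + n.+1))) (x n) = q n.
    have := sG (m + n.+1)%N; have [t ->] := s_cat m n.+1; rewrite sS.
    by rewrite [g _]surjective_pairing; exact: gen_cat_colon.
  apply/seteqP; split=> a; last by rewrite -(colonS 0) => ?; exists n.+1.
  move=> [m h]; rewrite -(colonS m); apply: genS h; exact: leq_addr.
have qP n : is_prime (q n).
  by have := sG n.+1; rewrite sS [g _]surjective_pairing => -[].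
have q_inj m n : (m < n)%N -> q m != q n.
  move=> mn; have := sG n.+1; rewrite sS [g _]surjective_pairing => -[_ _ _ + _].
  apply: contraNneq => e; rewrite -/(q n) -e -(subnK mn).
  have [t ->] := s_cat (n - m.+1)%N m.+1.
  by rewrite sS map_cat mem_cat mem_head orbT.
have [N NE] := submod_bundle LP.
have /WL : exists y, y \notin N.
  exists (x 0); apply/negP => Nx; have [_ q1 _] := qP 0; apply: q1.
  by rewrite -Lx /colon NE /= scale1r.
rewrite Ass_quotmod -NE => finL; apply: infinite_nat.
have q_injective : {in [set: nat] &, injective q}.
  move=> m n _ _ e; case: (ltngtP m n) => // /q_inj; by rewrite e eqxx.
rewrite -(eq_finite_set (inj_card_eq q_injective)); apply: sub_finite_set finL.
by move=> _ [n _ <-]; split=> //; exists (x n).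
Qed.

End Construction.

End Noetherian.

Theorem theorem0p2 (R : comNzRingType) (M : lmodType R)
    (hR : noetherian R) (hM : exists x : M, x != 0) :
  weakly_laskerian M <-> FSF M.
Proof.
split; [exact: weakly_laskerian_FSF|exact: FSF_weakly_laskerian].
Qed.
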